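(* (i) $\ker(\psi_d)$ is a binomial ideal of $S'$ minimally generated by quadrics. (ii) $I(S_{D_{2d}})=\tilde\rho(\ker(\psi_d))$, and a minimal set of generators of $I(S_{D_{2d}})$ is the following sets of binomials and trinomials: $$\{\,w_{(r_1,\gamma_1)}w_{(r_2,\gamma_2)}-w_{(r_3,\gamma_3)}w_{(r_4,\gamma_4)} \;\mid\; (r_i,\gamma_i)\neq(2,0),\ r_1+r_2=r_3+r_4,\ \gamma_1+\gamma_2=\gamma_3+\gamma_4\,\},$$ $$\{\,(w_{(2,0)}+2w_{(d,d)})\,w_{(\gamma_1,\gamma_1)}-w_{(r_2,\gamma_2)}w_{(r_3,\gamma_3)} \;\mid\; (r_i,\gamma_i)\neq(2,0),\ \gamma_1+2=r_2+r_3,\ \gamma_1=\gamma_2+\gamma_3\,\},$$ where all index pairs range over $\Lambda_d$.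
   Context: Let $k$ be an algebraically closed field of characteristic zero and $d\ge3$ an integer. Let $\Lambda_d$ be the set of pairs of integers $(r,\gamma)$ with $0\le r\le 2(d-1)$ and $\max\{0,\lceil\frac{(r-2)d}{d-2}\rceil\}\le\gamma\le r$. Let $S=k[w_{(r,\gamma)}]_{(r,\gamma)\in\Lambda_d}$ and $S'=k[z_{(r,\gamma)}]_{(r,\gamma)\in\Lambda_d}$ be standard graded polynomial rings. Define the ring homomorphism $\varphi_d:S\to k[x_0,x_1,x_2]$ by $$\varphi_d(w_{(r,\gamma)})=\begin{cases}x_0^{2d-2\gamma}x_1^\gamma x_2^\gamma & \text{if } r=\gamma,\\ x_0^{(2-r)d+(d-2)\gamma}\bigl(x_1^{rd-(d-1)\gamma}x_2^\gamma+x_1^\gamma x_2^{rd-(d-1)\gamma}\bigr)&\text{otherwise.}\end{cases}$$ The forms $\varphi_d(w_{(r,\gamma)})$ are pairwise distinct forms of degree $2d$; they are a minimal set of generators of the ideal $I_{2d}$ generated by all forms of degree $2d$ that are invariant under the dihedral group $D_{2d}$ of order $2d$ acting on $k[x_0,x_1,x_2]$ with a generator of order $d$ acting as a generator of the cyclic group $\langle\mathrm{diag}(1,e,e^{d-1})\rangle$ ($e$ a primitive $d$-th root of $1$) and a generator of order $2$ acting by fixing $x_0$ and interchanging $x_1,x_2$. They define a morphism from $\mathbb{P}^2$ whose image is the surface $S_{D_{2d}}$ (the $GT$-surface with group $D_{2d}$), and its homogeneous ideal is $I(S_{D_{2d}})=\ker(\varphi_d)\subset S$. Let $\psi_d:S'\to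 k[y_0,y_1,y_2]$ be the ring homomorphism $\psi_d(z_{(r,\gamma)})=y_0^{d(2-r)+(d-2)\gamma}y_1^{\gamma}y_2^{r-\gamma}$. It maps the variables $z_{(r,\gamma)}$ bijectively onto the set of monomials $\mathcal{A}_{2d}=\{y_0^{b_0}y_1^{b_1}y_2^{b_2}\mid b_0+2b_1+db_2=2d\}$. Let $\tilde\rho:S'\to S$ be the isomorphism of $k$-algebras given by $\tilde\rho(z_{(r,\gamma)})=w_{(r,\gamma)}$ for $(r,\gamma)\ne(2,0)$ and $\tilde\rho(z_{(2,0)})=w_{(2,0)}+2w_{(d,d)}$. A binomial ideal is one generated by differences of two monomials.
   Formalization: The listed set contains 0, both f and −f, and for d≥4 dependent triples, so it is not literally minimal; proved instead: it generates, each nonzero element lies in a minimal generating subset, and its minimal generating subsets are exactly the k-bases of its span contained in it. *)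

(* Defs.v *)
From HB Require Import structures.
From mathcomp Require Import all_boot all_order all_algebra.
From mathcomp Require Import mpoly.

Set Implicit Arguments.
Unset Strict Implicit.
Unset Printing Implicit Defensive.

Import Order.TTheory GRing.Theory Num.Theory.
Local Open Scope ring_scope.

Definition subset_of (T : Type) (A B : T -> Prop) : Prop := forall x, A x -> B x.
Definition same_set (T : Type) (A B : T -> Prop) : Prop := forall x, A x <-> B x.
Definition image_of (T U : Type) (f : T -> U) (A : T -> Prop) (y : U) : Prop :=
  exists2 x, A x & y = f x.

Section Generation.
Variables (A : nzRingType) (V : lmodType A).

Definition span_of (G : V -> Prop) (p : V) : Prop :=
  exists s : seq (A * V),
    (forall x, x \in s -> G x.2) /\ p = \sum_(x <- s) x.1 *: x.2.

Definition generates (G M : V -> Prop) : Prop := same_set M (span_of G).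

(* No proper subset of G still generates M.  Over a field, this says that G
   is a basis of M. *)
Definition minimally_generates (G M : V -> Prop) : Prop :=
  generates G M /\
  forall G', subset_of G' G -> generates G' M -> subset_of G G'.

End Generation.

(* Ideals of R are the submodules of the regular module R^o. *)
Definition ideal_generated (R : comNzRingType) (G I : R -> Prop) : Prop :=
  @generates R R^o G I.
Definition ideal_minimally_generated (R : comNzRingType) (G I : R -> Prop)
  : Prop := @minimally_generates R R^o G I.

Section Binomials.
Variables (R : comNzRingType) (n : nat).

Definition is_binomial (p : {mpoly R[n]}) : Prop :=
  exists m1 m2 : 'X_{1..n}, p = 'X_[m1] - 'X_[m2].

Definition binomial_ideal (I : {mpoly R[n]} -> Prop) : Prop :=
  exists G, (forall g, G g -> is_binomial g) /\ ideal_generated G I.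

End Binomials.

Definition in_Lambda (d r g : nat) : bool :=
  (r <= 2 * (d - 1))%N &&
  (Order.max 0 (Num.ceil ((r%:R - 2) * d%:R / (d%:R - 2) : rat)) <= g%:Z <= r%:Z).

(* Pairs in Lambda_d satisfy 0 <= g <= r <= 2(d-1), so bounding both components
   loses nothing and makes the index set a finType. *)
Definition Lambda (d : nat) :=
  {p : 'I_(2 * (d - 1)).+1 * 'I_(2 * (d - 1)).+1 | in_Lambda d p.1 p.2}.

Definition fstL d (l : Lambda d) : nat := (val l).1.
Definition sndL d (l : Lambda d) : nat := (val l).2.

(* The polynomial ring with variables indexed by Lambda_d: it serves both as
   S (variables w) and as S' (variables z). *)
Notation polyLambda k d := {mpoly k[#|{: Lambda d}|]}.

Definition var (k : nzRingType) (d : nat) (l : Lambda d) : polyLambda k d :=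
  'X_(enum_rank l).

(* The k-algebra homomorphism sending the variable of index l to f l. *)
Definition subst_vars (k : comNzRingType) (d n : nat)
  (f : Lambda d -> {mpoly k[n]}) (p : polyLambda k d) : {mpoly k[n]} :=
  p \mPo [tuple f (enum_val i) | i < #|{: Lambda d}|].

Definition kernel (U V : nmodType) (f : U -> V) (p : U) : Prop := f p = 0.

(* The 'I_3-indexed variables x_0, x_1, x_2 (or y_0, y_1, y_2) with integer
   exponents.  All exponents used below are nonnegative on Lambda_d, so the
   absolute value only serves to turn them into natural numbers. *)
Definition mon3 (k : nzRingType) (a b c : int) : {mpoly k[3]} :=
  'X_(inord 0) ^+ `|a|%N * 'X_(inord 1) ^+ `|b|%N * 'X_(inord 2) ^+ `|c|%N.

Section Maps.
Variables (k : comNzRingType) (d : nat).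

Definition phi_var (l : Lambda d) : {mpoly k[3]} :=
  let D := d%:Z in let r := (fstL l)%:Z in let g := (sndL l)%:Z in
  if r == g then mon3 k (2 * D - 2 * g) g g
  else mon3 k ((2 - r) * D + (D - 2) * g) (r * D - (D - 1) * g) g
     + mon3 k ((2 - r) * D + (D - 2) * g) g (r * D - (D - 1) * g).

Definition phi : polyLambda k d -> {mpoly k[3]} := subst_vars phi_var.

Definition psi_var (l : Lambda d) : {mpoly k[3]} :=
  let D := d%:Z in let r := (fstL l)%:Z in let g := (sndL l)%:Z in
  mon3 k (D * (2 - r) + (D - 2) * g) g (r - g).

Definition psi : polyLambda k d -> {mpoly k[3]} := subst_vars psi_var.

(* The homogeneous ideal of the GT-surface S_{D_2d}. *)
Definition surface_ideal : polyLambda k d -> Prop := kernel phi.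

End Maps.

Lemma in_Lambda_20 d : (3 <= d)%N -> in_Lambda d 2 0.
Proof.
by case: d => [|[|[|d]]] // _; rewrite /in_Lambda subrr !mul0r ceil0 maxxx !lexx.
Qed.

Lemma in_Lambda_dd d : (3 <= d)%N -> in_Lambda d d d.
Proof.
move=> d3; have d2 : (0 : rat) < d%:R - 2.
  by rewrite subr_gt0 (ltr_nat _ 2 d).
rewrite /in_Lambda lexx andbT ge_max ceil_le_int mulrAC divff ?gt_eqF // mul1r.
rewrite lexx !andbT.
by case: d d3 {d2} => [|[|d]] // _; rewrite subn1 /= mulSn mul1n addSnnS leq_addl.
Qed.

Lemma in_Lambda_bound d r g : in_Lambda d r g ->
  (r < (2 * (d - 1)).+1)%N && (g < (2 * (d - 1)).+1)%N.
Proof. by case/and3P=> hr _ hg; rewrite !ltnS hr (leq_trans _ hr). Qed.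

Definition idx d r g (h : in_Lambda d r g) : Lambda d :=
  let b := andP (in_Lambda_bound h) in
  exist _ (Ordinal (proj1 b), Ordinal (proj2 b)) h.

Section Surface.
Variables (k : comNzRingType) (d : nat) (hd : (3 <= d)%N).

Let i20 : Lambda d := idx (in_Lambda_20 hd).
Let idd : Lambda d := idx (in_Lambda_dd hd).
Let w (l : Lambda d) : polyLambda k d := var k l.

Definition rho_tilde : polyLambda k d -> polyLambda k d :=
  subst_vars (fun l => if l == i20 then w i20 + 2 * w idd else w l).

Definition binomials (p : polyLambda k d) : Prop :=
  exists l1 l2 l3 l4 : Lambda d,
    [/\ [/\ l1 != i20, l2 != i20, l3 != i20 & l4 != i20],
        (fstL l1 + fstL l2 = fstL l3 + fstL l4)%N,
        (sndL l1 + sndL l2 = sndL l3 + sndL l4)%N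
      & p = w l1 * w l2 - w l3 * w l4].

Definition trinomials (p : polyLambda k d) : Prop :=
  exists l1 l2 l3 : Lambda d,
    [/\ fstL l1 = sndL l1,
        l2 != i20 /\ l3 != i20,
        (sndL l1 + 2 = fstL l2 + fstL l3)%N,
        (sndL l1 = sndL l2 + sndL l3)%N
      & p = (w i20 + 2 * w idd) * w l1 - w l2 * w l3].

Definition quadrics (p : polyLambda k d) : Prop := binomials p \/ trinomials p.

End Surface.

(* G minimally generates I up to k-linear redundancy: G contains 0, both signs
   of each element, and (for large d) linearly dependent families such as
   a - b, b - c, a - c, so it cannot be literally irredundant.  The clauses say
   that G generates I; that no nonzero element of G is superfluous, i.e. each
   one belongs to a minimal set of generators of I contained in G; and that the
   minimal sets of generators of I contained in G are exactly the k-bases of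
   the linear span of G contained in G. *)
Definition minimally_generates_up_to_linear (k : fieldType) (n : nat)
  (G I : {mpoly k[n]} -> Prop) : Prop :=
  [/\ ideal_generated G I,
      forall g, G g -> g != 0 ->
        exists B, [/\ subset_of B G, B g & ideal_minimally_generated B I]
    & forall B, subset_of B G ->
        (ideal_minimally_generated B I <->
         @minimally_generates k {mpoly k[n]} B
           (@span_of k {mpoly k[n]} G))].

(* Main.v *)
Require Import Defs.
From HB Require Import structures.
From mathcomp Require Import all_boot all_order all_algebra.
From mathcomp Require Import mpoly zify ring.
From Stdlib Require Classical_Prop.
Import Order.TTheory GRing.Theory Num.Theory.
Local Open Scope ring_scope.

Set Implicit Arguments.
Unset Strict Implicit.
Unset Printing Implicit Defensive.

(** A pair (r, g) of Lambda_d is best read as the lattice point (g, r - g): in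
these coordinates Lambda_d is the set of lattice points (g, b) of the triangle
2g + db <= 2d, that is a bottom row (0,0), ..., (d,0), a middle row (0,1), ...,
(floor(d/2),1) and the apex (0,2), and psi is the monomial parametrization of
the toric surface of this triangle, the exponent of y_0 recording the degree.

The kernel of psi is generated by quadrics.  Fix a degree N and a total (G,B).
There is a point, depending only on (G,B), such that every monomial of degree N
with total (G,B) can be brought by quadratic moves to contain this point: the
apex if B >= 2, and otherwise the rightmost point of row B whose abscissa does
not exceed G ([head_pt]).  This takes one move for each point added
([head_exchange]).  Peeling off this point repeatedly gives a normal form
([normal_mnm]) which depends only on N, G and B, hence only on the image under
psi ([monomial_normal]).  So a polynomial p is congruent to the sum of its
coefficients times the normal forms of its monomials; that sum is a linear
function of psi p, so it vanishes when psi p does ([toric_quadrics_generate]).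

The surface is the same toric surface in other coordinates.  The invariants
x_0, x_1 x_2 and x_1^d + x_2^d are algebraically independent, so the
substitution theta of them for y_0, y_1, y_2 is injective ([theta_inj]).
Moreover phi sends w_(r,g) to theta (psi z_(r,g)), except that
  x_1^(2d) + x_2^(2d) = (x_1^d + x_2^d)^2 - 2 (x_1 x_2)^d
for (r,g) = (2,0), which is what rho_tilde corrects.  Thus
phi o rho_tilde = theta o psi ([phi_rho]), and rho_tilde being onto, the kernel
of phi is the image of the kernel of psi ([surface_ideal_image]).  Up to sign and
up to zero, the images of the toric quadrics are the binomials and trinomials of
the statement ([quadrics_generate]).

For minimality, all generators have degree 2.  Taking degree 2 parts shows
that a subset of them generates the ideal exactly when it spans the same vector
space over k ([ideal_generated_span]).  Minimal sets of generators are then bases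
of a space with a finite spanning set, and every nonzero element of such a set
lies in a basis contained in it ([basis_through]). *)

(** * Spans, ideals and minimal generating sets *)

Section Span.
Variables (A : nzRingType) (V : lmodType A).
Implicit Types (G H M : V -> Prop) (u v : V) (a : A).

Lemma span0 G : span_of G 0.
Proof. by exists [::]; rewrite big_nil. Qed.

Lemma spanP G M :
  M 0 -> (forall a v u, G v -> M u -> M (a *: v + u)) ->
  subset_of (span_of G) M.
Proof.
move=> M0 MG p [s [Gs ->]]; elim: s Gs => [|x s IHs] Gs; first by rewrite big_nil.
rewrite big_cons; apply: MG; first by apply: Gs; rewrite mem_head.
by apply: IHs => y ys; apply: Gs; rewrite inE ys orbT.
Qed.

Lemma span_gen G v : G v -> span_of G v.
Proof.
move=> Gv; exists [:: (1, v)]; rewrite big_seq1 scale1r; split=> // x.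
by rewrite inE => /eqP ->.
Qed.

Lemma spanD G u v : span_of G u -> span_of G v -> span_of G (u + v).
Proof.
move=> [s [Gs ->]] [t [Gt ->]]; exists (s ++ t); rewrite big_cat; split=> // x.
by rewrite mem_cat => /orP[/Gs|/Gt].
Qed.

Lemma spanZ G a v : span_of G v -> span_of G (a *: v).
Proof.
move=> [s [Gs ->]]; exists [seq (a * x.1, x.2) | x <- s]; split.
  by move=> x /mapP[y /Gs Gy ->].
by rewrite big_map scaler_sumr; apply: eq_bigr => x _; rewrite scalerA.
Qed.

Lemma spanN G v : span_of G v -> span_of G (- v).
Proof. by move/(spanZ (-1)); rewrite scaleN1r. Qed.

Lemma spanB G u v : span_of G u -> span_of G v -> span_of G (u - v).
Proof. by move=> Gu /spanN; apply: spanD. Qed.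

Lemma span_sum G (I : eqType) (s : seq I) (F : I -> V) :
  (forall i, i \in s -> span_of G (F i)) -> span_of G (\sum_(i <- s) F i).
Proof.
elim: s => [|i s IHs] GF; first by rewrite big_nil; apply: span0.
rewrite big_cons; apply: spanD; first by apply: GF; rewrite mem_head.
by apply: IHs => j js; apply: GF; rewrite inE js orbT.
Qed.

Lemma span_sub G H :
  subset_of G (span_of H) -> subset_of (span_of G) (span_of H).
Proof.
move=> sGH; apply: spanP => [|a v u /sGH Hv Hu]; first exact: span0.
by apply: spanD => //; apply: spanZ.
Qed.

Lemma span_mono G H : subset_of G H -> subset_of (span_of G) (span_of H).
Proof. by move=> sGH; apply: span_sub => v /sGH; apply: span_gen. Qed.

End Span.

Section Ideals.
Variable R : comNzRingType.
Implicit Types (G M : R -> Prop) (a p q : R).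
Local Notation ideal G := (@span_of R R^o G).

Lemma idealP G M :
  M 0 -> (forall a g p, G g -> M p -> M (a * g + p)) -> subset_of (ideal G) M.
Proof. exact: (@spanP R R^o). Qed.

Lemma ideal_gen G g : G g -> ideal G g.
Proof. exact: (@span_gen R R^o). Qed.

Lemma idealD G p q : ideal G p -> ideal G q -> ideal G (p + q).
Proof. exact: (@spanD R R^o). Qed.

Lemma idealM G a p : ideal G p -> ideal G (a * p).
Proof. exact: (@spanZ R R^o). Qed.

Lemma ideal_trans G p q r : ideal G (p - q) -> ideal G (q - r) -> ideal G (p - r).
Proof. by move=> hpq /(idealD hpq); rewrite addrA subrK. Qed.

Lemma ideal_sub G (H : R -> Prop) :
  subset_of G (ideal H) -> subset_of (ideal G) (ideal H).
Proof. exact: (@span_sub R R^o). Qed.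

End Ideals.

Section Bases.
Variables (k : fieldType) (V : lmodType k).
Implicit Types (s t : seq V) (g : V).

(** Removing x by value, not by position, makes repetitions in t harmless. *)
Definition others t x : V -> Prop := fun y => (y \in t) /\ y <> x.

(** Discarding one at a time the redundant vectors outside K ends, s being
finite. *)
Lemma prune (K : pred V) s : exists t,
  [/\ {subset t <= s}, {in s, forall x, K x -> x \in t},
      subset_of (span_of (fun x => x \in s)) (span_of (fun x => x \in t))
    & forall x, x \in t -> ~~ K x -> ~ span_of (others t x) x].
Proof.
have [n] := ubnP (size s); elim: n s => // n IHn s szs.
have [[x [xs Kx sp]]|irr] := Classical_Prop.classic
  (exists x, [/\ x \in s, ~~ K x & span_of (others s x) x]); last first.
  by exists s; split=> // x xs Kx sp; apply: irr; exists x.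
have [|t [tsub tK tsp tirr]] := IHn [seq y <- s | y != x].
  rewrite size_filter (leq_trans _ (szs : (_ <= n)%N)) //.
  rewrite -(count_predC (fun y => y != x)) -addn1 leq_add2l -has_count.
  by apply/hasP; exists x => //=; rewrite negbK.
exists t; split=> //.
- by move=> y /tsub; rewrite mem_filter => /andP[].
- move=> y ys Ky; apply: tK => //; rewrite mem_filter ys andbT.
  by apply: contraNneq Kx => <-.
- apply: span_sub => y ys; apply: tsp.
  have [->|yx] := eqVneq y x.
    apply: span_mono sp => z [zs /eqP zx].
    by rewrite mem_filter zx.
  by apply: span_gen; rewrite mem_filter yx.
Qed.

(** Steinitz exchange: a nonzero combination g of t involves some x of t with a
nonzero coefficient, for which the relation can be solved. *)
Lemma exchange t g : g <> 0 -> span_of (fun x => x \in t) g ->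
  exists2 x, x \in t & span_of (fun y => y = g \/ others t x y) x.
Proof.
move=> g0; elim: t => [|y t IHt] sp.
  case: g0; move: g sp; exact: spanP.
have keep : span_of (fun x => x \in t) g ->
  exists2 x, x \in y :: t & span_of (fun z => z = g \/ others (y :: t) x z) x.
  move/IHt => [x xt spx]; exists x; first by rewrite inE xt orbT.
  apply: span_mono spx => z [->|[zt zx]]; [by left|right].
  by split=> //; rewrite inE zt orbT.
have [yt|yt] := boolP (y \in t).
  apply: keep; apply: span_mono sp => z.
  by rewrite inE => /orP[/eqP ->|].
have [c [u [spu gE]]] : exists c u, span_of (fun x => x \in t) u /\ g = c *: y + u.
  move: g sp {g0 IHt keep}; apply: spanP => [|a v u].
    by exists 0, 0; split; [apply: span0|rewrite scale0r addr0].
  rewrite inE => /orP[/eqP->|vt] [c [w [spw ->]]].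
    by exists (a + c), w; rewrite scalerDl addrA.
  exists c, (a *: v + w); split; last by rewrite addrCA.
  by apply: spanD => //; apply/spanZ/span_gen.
have [c0|c0] := eqVneq c 0.
  by apply: keep; rewrite gE c0 scale0r add0r.
exists y; first by rewrite mem_head.
rewrite [X in span_of _ X](_ : y = c^-1 *: (g - u)); last first.
  by rewrite gE addrK scalerA mulVf // scale1r.
apply/spanZ/spanB; first by apply: span_gen; left.
apply: span_mono spu => z zt; right; split; first by rewrite inE zt orbT.
by move=> zy; rewrite -zy zt in yt.
Qed.

Lemma irredundant_minimal (M : V -> Prop) t :
  generates (fun x => x \in t) M ->
  (forall x, x \in t -> ~ span_of (others t x) x) ->
  minimally_generates (fun x => x \in t) M.
Proof.
move=> gen irr; split=> // G' sG' gen' x xt; apply: Classical_Prop.NNPP => G'x.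
apply: (irr x xt).
have : span_of G' x by apply/gen'/gen/span_gen.
apply: span_mono => y G'y; split; first exact: sG'.
by move=> yx; rewrite yx in G'y.
Qed.

Lemma basis_within (G : V -> Prop) s : (forall x, G x <-> x \in s) ->
  exists B, subset_of B G /\ minimally_generates B (span_of G).
Proof.
move=> Gs; have [t [ts _ tsp irr]] := prune pred0 s.
exists (fun x => x \in t); split=> [x /ts|]; first by move/Gs.
apply: irredundant_minimal => [x|x xt]; last exact: irr.
split=> [spx|]; last by apply: span_mono => y /ts /Gs.
by apply: tsp; apply: span_mono spx => y /Gs.
Qed.

(** Pruning everything redundant except g leaves only g possibly redundant; but
then exchanging g makes another remaining vector redundant. *)
Lemma basis_through (G : V -> Prop) s g :
  (forall x, G x <-> x \in s) -> G g -> g <> 0 ->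
  exists B, [/\ subset_of B G, B g & minimally_generates B (span_of G)].
Proof.
move=> Gs Gg g0; have [t [ts tg tsp irr]] := prune (pred1 g) s.
exists (fun x => x \in t); split=> [x /ts||]; first by move/Gs.
  by apply: tg; [apply/Gs|rewrite /= eqxx].
apply: irredundant_minimal => [x|x xt sp].
  split=> [spx|]; last by apply: span_mono => y /ts /Gs.
  by apply: tsp; apply: span_mono spx => y /Gs.
have [xg|xg] := eqVneq x g; last by apply: (irr x).
have [|y] := @exchange [seq y <- t | y != g] g g0.
  rewrite -{2}xg; apply: span_mono sp => z [zt /eqP zx].
  by rewrite mem_filter zt -xg zx.
rewrite mem_filter => /andP[yg yt] spy; apply: (irr y yt); first exact: yg.
apply: span_mono spy => z [->|[]].
  by rewrite -{1}xg; split=> // gy; rewrite -gy xg eqxx in yg.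
by rewrite mem_filter => /andP[_ zt] zy.
Qed.

End Bases.

Section HomogeneousGenerators.
Variables (k : fieldType) (n d : nat).
Local Notation R := {mpoly k[n]}.
Implicit Types (G I B : R -> Prop) (a b p : R).

(** Only the constant term of a contributes in degree d, b being homogeneous of
degree d: this is what turns ideal membership into linear algebra. *)
Lemma pihomog_mul a b : b \is d.-homog -> pihomog mdeg d (a * b) = a@_0 *: b.
Proof.
move=> hb; rewrite {1}[a]mpolyE mulr_suml raddf_sum /=.
have E m : pihomog mdeg d (a@_m *: 'X_[m] * b) =
    if m == 0%MM then a@_m *: b else 0.
  rewrite -scalerAl linearZ /=; case: eqVneq => [->|m0].
    by rewrite mpolyX0 mul1r pihomog_dE.
  rewrite (@pihomog_ne0 _ _ _ (mdeg m + d)) ?scaler0 //.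
    by rewrite -[X in _ != X]add0n eqn_add2r mdeg_eq0.
  by apply: dhomogM => //; rewrite dhomogX.
rewrite (eq_bigr _ (fun m _ => E m)) -big_mkcond /= -scaler_suml.
congr (_ *: _).
have [in0|nin0] := boolP (0%MM \in msupp a).
  by rewrite -big_filter filter_pred1_uniq ?msupp_uniq // big_seq1.
rewrite memN_msupp_eq0 // big1_seq // => m /andP[/eqP->].
by rewrite (negbTE nin0).
Qed.

Lemma ideal_homog G p : (forall g, G g -> g \is d.-homog) -> p \is d.-homog ->
  @span_of R R^o G p -> @span_of k R G p.
Proof.
move=> hG hp Gp; rewrite -(pihomog_dE hp).
move: p Gp {hp}.
apply: (@idealP R G (fun p => @span_of k R G (pihomog mdeg d p))).
  by rewrite pihomog0; apply: span0.
move=> a b p Gb spp; rewrite pihomogD; apply: spanD => //.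
rewrite pihomog_mul; last exact: hG.
exact/spanZ/span_gen.
Qed.

Lemma linear_span_ideal G p : @span_of k R G p -> @span_of R R^o G p.
Proof.
move: p; apply: (@spanP k R G (@span_of R R^o G)); first exact: span0.
move=> a b p Gb spp; apply: idealD => //; rewrite -mul_mpolyC; exact/idealM/ideal_gen.
Qed.

(** Nakayama's lemma in the graded case, for generators of a single degree. *)
Lemma ideal_generated_span G I B : (forall g, G g -> g \is d.-homog) ->
  ideal_generated G I -> subset_of B G ->
  (ideal_generated B I <-> generates B (@span_of k R G)).
Proof.
move=> hG genG sBG; split=> [genB|genB].
  move=> p; split; last exact: span_mono.
  apply: span_sub => g Gg; apply: ideal_homog; last 2 first.
  - exact: hG.
  - exact/genB/genG/span_gen.
  by move=> b /sBG; apply: hG.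
move=> p; split; last by move=> Bp; apply/genG; apply: span_mono Bp.
move/genG; apply: ideal_sub => g Gg.
exact/linear_span_ideal/genB/span_gen.
Qed.

Lemma minimal_ideal_generators_span G I B : (forall g, G g -> g \is d.-homog) ->
  ideal_generated G I -> subset_of B G ->
  (ideal_minimally_generated B I <->
   @minimally_generates k R B (@span_of k R G)).
Proof.
move=> hG genG sBG.
have E B' : subset_of B' B ->
    (ideal_generated B' I <-> generates B' (@span_of k R G)).
  by move=> sB'B; apply: ideal_generated_span => // x /sB'B /sBG.
split=> -[gen irr]; split; try exact/E; by move=> B' sB' /(E _ sB'); apply: irr.
Qed.

Lemma homog_minimally_generates G I (s : seq R) :
  (forall g, G g -> g \is d.-homog) -> (forall g, G g <-> g \in s) ->
  ideal_generated G I -> minimally_generates_up_to_linear G I.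
Proof.
move=> hG Gs genG; split=> // [g Gg /eqP g0|B sBG].
  have [B [sBG Bg mB]] := basis_through Gs Gg g0.
  by exists B; split=> //; apply/(minimal_ideal_generators_span hG genG sBG).
exact: minimal_ideal_generators_span.
Qed.

Lemma homog_minimal_generators_exist G I (s : seq R) :
  (forall g, G g -> g \is d.-homog) -> (forall g, G g <-> g \in s) ->
  ideal_generated G I ->
  exists B, subset_of B G /\ ideal_minimally_generated B I.
Proof.
move=> hG Gs genG; have [B [sBG mB]] := basis_within Gs.
by exists B; split=> //; apply/(minimal_ideal_generators_span hG genG sBG).
Qed.

End HomogeneousGenerators.

(** * The lattice points of the triangle *)

Section LatticePoints.
Variables (d : nat) (hd : (3 <= d)%N).
Implicit Types (l x y z : Lambda d) (g b r G B N : nat).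

(** The lower bound on g says that the exponent of y_0 is nonnegative, and the
bound r <= 2(d-1) follows from it. *)
Lemma in_LambdaE r g :
  in_Lambda d r g = (g <= r)%N && (2 * g + d * (r - g) <= 2 * d)%N.
Proof.
have d2 : (0 : rat) < d%:R - 2 by rewrite subr_gt0 (ltr_nat _ 2 d).
rewrite /in_Lambda ge_max lez_nat ceil_le_int ler_pdivrMr // andbA.
have -> : ((r%:R - 2) * d%:R <= (g%:Z)%:~R * (d%:R - 2) :> rat) =
          (r * d + 2 * g <= g * d + 2 * d)%N.
  rewrite -(ler_nat rat) !natrD !natrM -pmulrn.
  rewrite -[LHS]subr_ge0 -[RHS]subr_ge0; congr (0 <= _); ring.
rewrite andbC; case: leqP => //= gr.
have -> : (r * d + 2 * g <= g * d + 2 * d)%N = (2 * g + d * (r - g) <= 2 * d)%N.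
  by rewrite -{1}(subnK gr); nia.
apply: andb_idl => h.
have : (r - g <= 2)%N by nia.
by case: (r - g)%N (subnK gr) h => [|[|[|e]]] // <- h _; nia.
Qed.

(** The second coordinate in the triangle, which is also the exponent of y_2
in the image under psi of the variable of index l. *)
Definition ht l := (fstL l - sndL l)%N.

Lemma LambdaP l : (sndL l <= fstL l)%N /\ (2 * sndL l + d * ht l <= 2 * d)%N.
Proof. by have := valP l; rewrite in_LambdaE => /andP. Qed.

Lemma fstLE l : fstL l = (sndL l + ht l)%N.
Proof. by rewrite /ht subnKC //; case: (LambdaP l). Qed.

Lemma Lambda_eq x y : sndL x = sndL y -> ht x = ht y -> x = y.
Proof.
move=> es eh; have ef : fstL x = fstL y by rewrite !fstLE es eh.
apply: val_inj; move: ef es; rewrite /fstL /sndL.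
by case: (val x) (val y) => [a b] [a' b'] /= /val_inj -> /val_inj ->.
Qed.

Lemma idx20 : sndL (idx (in_Lambda_20 hd)) = 0%N /\ ht (idx (in_Lambda_20 hd)) = 2%N.
Proof. by []. Qed.

Lemma idxdd : sndL (idx (in_Lambda_dd hd)) = d /\ ht (idx (in_Lambda_dd hd)) = 0%N.
Proof. by rewrite /ht /sndL /fstL /= subnn. Qed.

Lemma ht_le2 l : (ht l <= 2)%N.
Proof. by have [_ h] := LambdaP l; nia. Qed.

(** The apex is the only point of the top row. *)
Lemma ht_le1 l : l != idx (in_Lambda_20 hd) -> (ht l <= 1)%N.
Proof.
move=> l20; have [_ h] := LambdaP l; have := ht_le2 l.
rewrite leq_eqVlt => /orP[/eqP h2|] //; case/eqP: l20.
by have [e0 e1] := idx20; apply: Lambda_eq; rewrite ?e0 ?e1 //; nia.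
Qed.

(** The lattice point (g, b), and the apex when (g, b) lies outside the triangle. *)
Definition pt g b : Lambda d :=
  insubd (idx (in_Lambda_20 hd)) (inord (g + b), inord g).

Lemma ptE g b : (2 * g + d * b <= 2 * d)%N -> sndL (pt g b) = g /\ ht (pt g b) = b.
Proof.
move=> h; have hin : in_Lambda d (g + b) g by rewrite in_LambdaE leq_addr addKn.
have /andP[hr hg] := in_Lambda_bound hin.
rewrite /ht /pt /sndL /fstL val_insubd /= !inordK // hin /= !inordK //.
by rewrite addKn.
Qed.

(** Greedy choice of a point to peel off.  For B >= 2 the apex can be produced
because (i, 1) + (j, 1) = (0, 2) + (i + j, 0), where i + j <= d; in the other
cases the abscissa is pushed as far right as G and the triangle permit. *)
Definition head_pt G B : Lambda d :=
  if (2 <= B)%N then pt 0 2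
  else if B == 1%N then pt (minn G d./2) 1 else pt (minn G d) 0.

(** The inequality cutting out the N-fold dilation of the triangle.  By
[head_pt_leq], all its lattice points are sums of N points of the triangle,
even for odd d, when the triangle is not a lattice polygon. *)
Definition realizable N G B := (2 * G + d * B <= 2 * d * N)%N.

Lemma head_ptE G B :
  sndL (head_pt G B) = (if 2 <= B then 0 else if B == 1 then minn G d./2 else minn G d)%N
  /\ ht (head_pt G B) = minn B 2.
Proof.
rewrite /head_pt; case: (leqP 2 B) => [B2|B2]; last case: eqP => [->|B1].
- have [-> ->] := @ptE 0 2 ltac:(lia); lia.
- have [] := @ptE (minn G d./2) 1 ltac:(lia); lia.
- have [] := @ptE (minn G d) 0 ltac:(lia); lia.
Qed.

(** The tight case is B = 1 and G > d/2 with d odd: the head then falls short of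
the edge of the triangle by half a unit, which the parity of 2G makes up for. *)
Lemma head_pt_leq N G B : realizable N.+1 G B ->
  [/\ (sndL (head_pt G B) <= G)%N, (ht (head_pt G B) <= B)%N
    & realizable N (G - sndL (head_pt G B)) (B - ht (head_pt G B))].
Proof.
rewrite /realizable => h; have [-> ->] := head_ptE G B.
case: (leqP 2 B) => [B2|B2].
  have [B' E] : exists B', B = (B' + 2)%N by exists (B - 2)%N; lia.
  by subst B; split; nia.
case: eqP => [E|B1]; first by subst B; split; nia.
have E : B = 0%N by lia.
by subst B; split; nia.
Qed.

(** Adding x to a multiset with head y: a single quadratic move on the pair x, y
brings up the head of the enlarged multiset. *)
Lemma head_exchange x G B :
  let y := head_pt G B in let y' := head_pt (sndL x + G) (ht x + B) in
  exists z : Lambda d,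
    (sndL x + sndL y = sndL y' + sndL z)%N /\ (ht x + ht y = ht y' + ht z)%N.
Proof.
move=> y y'; have [_ hx] := LambdaP x.
have [s1 h1] := head_ptE G B; have [s2 h2] := head_ptE (sndL x + G) (ht x + B).
rewrite -/y in s1 h1; rewrite -/y' in s2 h2.
suff [le1 le2 h] : [/\ sndL y' <= sndL x + sndL y, ht y' <= ht x + ht y
  & 2 * (sndL x + sndL y - sndL y') + d * (ht x + ht y - ht y') <= 2 * d]%N.
  have [e1 e2] := ptE h.
  by exists (pt (sndL x + sndL y - sndL y') (ht x + ht y - ht y')); lia.
rewrite s1 s2 h1 h2; move: hx; move: (sndL x) (ht x) => g b {s1 s2 h1 h2 y y'} hx.
have : (b <= 2)%N by nia.
case: b hx => [|[|[|b]]] // hx _.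
- case: B => [|[|B]] //=; rewrite ?add0n; split; nia.
- case: B => [|[|B]] //=; rewrite ?add1n; split; nia.
- case: B => [|[|B]] //=; split; nia.
Qed.

End LatticePoints.

(** * The toric ideal is generated by quadrics *)

Section Monomials3.
Variable k : comNzRingType.

Definition mnm3 (a b c : nat) : 'X_{1..3} :=
  [multinom nth 0%N [:: a; b; c] i | i < 3].

Lemma mnm3E (u : 'X_{1..3}) :
  u = mnm3 (u (inord 0)) (u (inord 1)) (u (inord 2)).
Proof.
apply/mnmP => -[[|[|[|i]]] hi] //; rewrite mnmE /=; congr (u _);
  by apply: val_inj; rewrite /= inordK.
Qed.

Lemma mnm3_coord a b c :
  [/\ mnm3 a b c (inord 0) = a, mnm3 a b c (inord 1) = b
    & mnm3 a b c (inord 2) = c].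
Proof. by split; rewrite mnmE inordK. Qed.

Lemma mon3E (a b c : int) : mon3 k a b c = 'X_[mnm3 `|a| `|b| `|c|].
Proof.
rewrite /mon3 !mpolyXn -!mpolyXD; congr 'X_[_]; rewrite [LHS]mnm3E.
by congr mnm3; rewrite !mnmDE !mulmnE !mnm1E -!val_eqE /= !inordK //=; lia.
Qed.

End Monomials3.

Lemma mnm_cons (n : nat) (m : 'X_{1..n}) :
  m = 0%MM \/ exists i m', m = (U_(i) + m')%MM.
Proof.
have [->|m0] := eqVneq m 0%MM; [by left|right].
have [i mi] : exists i, m i != 0%N.
  apply/existsP; apply: contraNT m0; rewrite negb_exists => /forallP m0.
  by apply/eqP/mnmP => i; rewrite mnm0E; apply/eqP; have := m0 i; rewrite negbK.
exists i, (m - U_(i))%MM; rewrite addmC submK //.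
by apply/mnm_lepP => j; rewrite mnm1E; case: eqP => // <-; rewrite lt0n.
Qed.

(** The monomials 'X_[u] are a basis, so u |-> F u extends linearly. *)
Lemma linear_relation (k : comNzRingType) (n : nat) (W : lmodType k)
    (I : eqType) (s : seq I) (c : I -> k) (u : I -> 'X_{1..n}) (F : 'X_{1..n} -> W) :
  \sum_(i <- s) c i *: 'X_[u i] = 0 :> {mpoly k[n]} ->
  \sum_(i <- s) c i *: F (u i) = 0.
Proof.
move=> rel; pose r := undup [seq u i | i <- s].
have coef m : \sum_(i <- s) c i * (u i == m)%:R = 0.
  have := congr1 (mcoeff m) rel; rewrite raddf_sum mcoeff0 /= => h; rewrite -[RHS]h.
  by apply: eq_bigr => i _; rewrite mcoeffZ mcoeffX.
transitivity (\sum_(i <- s) \sum_(m <- r) (c i * (u i == m)%:R) *: F m).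
  rewrite big_seq [RHS]big_seq; apply: eq_bigr => i si.
  rewrite (bigD1_seq (u i)) ?undup_uniq ?mem_undup ?map_f //= eqxx mulr1.
  rewrite big1 ?addr0 // => m; rewrite eq_sym => /negbTE ->.
  by rewrite mulr0 scale0r.
by rewrite exchange_big big1 //= => m _; rewrite -scaler_suml coef scale0r.
Qed.

Section ToricIdeal.
Variables (k : comNzRingType) (d : nat) (hd : (3 <= d)%N).
Local Notation R := (polyLambda k d).
Local Notation ideal G := (@span_of R R^o G).

Definition toric_quadrics (p : R) : Prop :=
  exists l1 l2 l3 l4 : Lambda d,
    [/\ (fstL l1 + fstL l2 = fstL l3 + fstL l4)%N,
        (sndL l1 + sndL l2 = sndL l3 + sndL l4)%N
      & p = var k l1 * var k l2 - var k l3 * var k l4].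

Definition expo_var (l : Lambda d) : 'X_{1..3} :=
  mnm3 (2 * d - (2 * sndL l + d * ht l)) (sndL l) (ht l).

Lemma expo_var_coord l :
  [/\ expo_var l (inord 0) = (2 * d - (2 * sndL l + d * ht l))%N,
      expo_var l (inord 1) = sndL l & expo_var l (inord 2) = ht l].
Proof. exact: mnm3_coord. Qed.

Lemma psi_varE l : psi_var k l = 'X_[expo_var l].
Proof.
rewrite /psi_var mon3E /expo_var; have [_ h] := LambdaP hd l.
by rewrite (fstLE hd l); congr 'X_[mnm3 _ _ _]; nia.
Qed.

Definition expo (m : 'X_{1..#|{: Lambda d}|}) : 'X_{1..3} :=
  (\sum_i expo_var (enum_val i) *+ m i)%MM.

Lemma expoD m1 m2 : expo (m1 + m2)%MM = (expo m1 + expo m2)%MM.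
Proof.
apply/mnmP => i; rewrite mnmDE !mnm_sumE -big_split /=.
by apply: eq_bigr => j _; rewrite !mulmnE mnmDE mulnDr.
Qed.

Lemma expoU i : expo U_(i)%MM = expo_var (enum_val i).
Proof.
rewrite /expo (bigD1 i) //= big1 => [|j ji].
  by rewrite mnm1E eqxx mulm1n addm0.
by rewrite mnm1E eq_sym (negbTE ji) mulm0n.
Qed.

Lemma psiX m : psi ('X_[m] : R) = 'X_[expo m].
Proof.
rewrite /psi /subst_vars comp_mpolyX /expo.
rewrite (big_morph _ (@mpolyXD _ k) (@mpolyX0 _ k)).
by apply: eq_bigr => i _; rewrite tnth_mktuple psi_varE mpolyXn.
Qed.

Lemma psiE (p : R) : psi p = \sum_(m <- msupp p) p@_m *: 'X_[expo m].
Proof.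
rewrite /psi /subst_vars comp_mpolyEX; apply: eq_bigr => m _.
by congr (_ *: _); apply: psiX.
Qed.

Fixpoint normal_mnm N G B : 'X_{1..#|{: Lambda d}|} :=
  if N is N'.+1 then
    let h := head_pt hd G B in
    (U_(enum_rank h) + normal_mnm N' (G - sndL h)%N (B - ht h)%N)%MM
  else 0%MM.

Lemma varE (l : Lambda d) : var k l = 'X_[U_(enum_rank l)]. Proof. by []. Qed.

Lemma toric_quadric_swap (x y z t : Lambda d) (q : R) :
  (sndL x + sndL y = sndL z + sndL t)%N -> (ht x + ht y = ht z + ht t)%N ->
  ideal toric_quadrics (var k x * var k y * q - var k z * var k t * q).
Proof.
move=> es eh; rewrite -mulrBl mulrC.
apply/idealM/ideal_gen; exists x, y, z, t; split=> //.
by rewrite !(fstLE hd); lia.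
Qed.

(** Multiplication by a variable is compatible with normal forms.  One move on x
and the first head gives the right first head and a new point z, to be merged
into the shorter normal form that remains. *)
Lemma normal_mnm_cons N G B (x : Lambda d) : realizable d N G B ->
  ideal toric_quadrics (var k x * 'X_[normal_mnm N G B]
    - 'X_[normal_mnm N.+1 (sndL x + G) (ht x + B)]).
Proof.
elim: N x G B => [|N IHN] x G B hr.
  have [E0 E1] : G = 0%N /\ B = 0%N by move: hr; rewrite /realizable; nia.
  rewrite E0 E1 !addn0 /=.
  suff -> : head_pt hd (sndL x) (ht x) = x.
    by rewrite addm0 mpolyX0 mulr1 subrr; apply: span0.
  have [_ hx] := LambdaP hd x; have [s1 h1] := head_ptE hd (sndL x) (ht x).
  have h2 := ht_le2 hd x.
  apply: (Lambda_eq hd); rewrite ?s1 ?h1; last lia.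
  by case: (ht x) hx h2 => [|[|[|]]] //=; nia.
have [hs hh hr'] := head_pt_leq hd hr.
have [z [es eh]] := head_exchange hd x G B.
set y := head_pt hd G B in hs hh hr' es eh *.
set y' := head_pt hd (sndL x + G) (ht x + B) in es eh.
have -> : normal_mnm N.+2 (sndL x + G) (ht x + B) =
    (U_(enum_rank y') +
     normal_mnm N.+1 (sndL z + (G - sndL y))%N (ht z + (B - ht y))%N)%MM.
  have -> : (sndL z + (G - sndL y) = sndL x + G - sndL y')%N by lia.
  by have -> : (ht z + (B - ht y) = ht x + B - ht y')%N by lia.
have IH := IHN z _ _ hr'; move: (normal_mnm N.+1 (sndL z + _) _) IH => m IH.
rewrite [normal_mnm N.+1 G B]/= -/y !mpolyXD -!varE.
move: 'X_[normal_mnm N _ _] IH => t IH.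
have := toric_quadric_swap t es eh; rewrite -!mulrA => /ideal_trans; apply.
by rewrite -mulrBr; apply/idealM.
Qed.

(** The degree of a monomial is read off its image under psi, since
u_0 + 2 u_1 + d u_2 = 2d for each variable ([expo_weight]). *)
Definition normal_of (u : 'X_{1..3}) :=
  normal_mnm ((u (inord 0) + (2 * u (inord 1) + d * u (inord 2))) %/ (2 * d))
    (u (inord 1)) (u (inord 2)).

Lemma expo_weight m : (expo m (inord 0) +
  (2 * expo m (inord 1) + d * expo m (inord 2)) = 2 * d * mdeg m)%N.
Proof.
rewrite !mnm_sumE mdegE !big_distrr -!big_split /=; apply: eq_bigr => i _.
rewrite !mulmnE; have [-> -> ->] := expo_var_coord (enum_val i).
by have [_ h] := LambdaP hd (enum_val i); nia.
Qed.

Lemma normal_of_expo m :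
  normal_of (expo m) = normal_mnm (mdeg m) (expo m (inord 1)) (expo m (inord 2)).
Proof. by rewrite /normal_of expo_weight mulKn //; lia. Qed.

Lemma monomial_normal m :
  ideal toric_quadrics ('X_[m] - 'X_[normal_of (expo m)]).
Proof.
rewrite normal_of_expo.
elim: {m}(mdeg m) {-2}m (erefl (mdeg m)) => [|N IHN] m.
  move/eqP; rewrite mdeg_eq0 => /eqP ->; rewrite mdeg0 /= subrr; exact: span0.
have [->|[i [m' ->]]] := mnm_cons m; first by rewrite mdeg0.
rewrite mdegD mdeg1 add1n => -[e]; have := IHN _ e.
set t := 'X_[normal_mnm _ _ _] => h1.
have hr : realizable d (mdeg m') (expo m' (inord 1)) (expo m' (inord 2)).
  by rewrite /realizable -expo_weight leq_addl.
have := normal_mnm_cons (enum_val i) hr; rewrite varE enum_valK -/t => h2.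
have /ideal_trans : ideal toric_quadrics ('X_i * 'X_[m'] - 'X_i * t).
  by rewrite -mulrBr; apply: idealM.
move/(_ _ h2); rewrite -mpolyXD expoD expoU !mnmDE.
by have [_ -> ->] := expo_var_coord (enum_val i).
Qed.

Lemma toric_quadrics_generate : ideal_generated toric_quadrics (kernel (@psi k d)).
Proof.
move=> p; split=> [kerp|]; last first.
  move: p; apply: idealP => [|a q p [l1 [l2 [l3 [l4 [ef es ->]]]]] kp].
    exact: raddf0.
  rewrite /kernel /psi /subst_vars raddfD /= [X in _ + X]kp addr0.
  rewrite rmorphM rmorphB !varE -!mpolyXD /= [X in _ * (X - _)]psiX.
  rewrite [X in _ * (_ - X)]psiX !expoD !expoU !enum_rankK.
  rewrite (_ : (_ + _)%MM = (expo_var l3 + expo_var l4)%MM) ?subrr ?mulr0 //.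
  have [_ h1] := LambdaP hd l1; have [_ h2] := LambdaP hd l2.
  have [_ h3] := LambdaP hd l3; have [_ h4] := LambdaP hd l4.
  rewrite !(fstLE hd) in ef.
  apply/mnmP => -[[|[|[|i]]] hi] //; rewrite !mnmDE /expo_var !mnmE /=; nia.
have nf0 : \sum_(m <- msupp p) p@_m *: 'X_[normal_of (expo m)] = 0 :> R.
  by apply: linear_relation (fun u => 'X_[normal_of u] : R) _; rewrite -psiE.
rewrite [p]mpolyE -[X in ideal _ X]subr0 -[X in _ - X]nf0 -sumrB.
apply: (@span_sum R R^o) => m _; rewrite -scalerBr -mul_mpolyC.
exact/idealM/monomial_normal.
Qed.

End ToricIdeal.

(** * The invariants of the dihedral group *)

Section Substitution.
Variables (k : comNzRingType) (d : nat).
Local Notation R := (polyLambda k d).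

Lemma subst_var n (f : Lambda d -> {mpoly k[n]}) l : subst_vars f (var k l) = f l.
Proof. by rewrite /subst_vars comp_mpolyXU -tnth_nth tnth_mktuple enum_rankK. Qed.

Lemma eq_subst n (f g : Lambda d -> {mpoly k[n]}) (p : R) :
  f =1 g -> subst_vars f p = subst_vars g p.
Proof.
by move=> fg; congr comp_mpoly; apply: eq_mktuple => i; apply: fg.
Qed.

Lemma subst_comp m n (f : Lambda d -> {mpoly k[m]}) (t : m.-tuple {mpoly k[n]}) (p : R) :
  subst_vars f p \mPo t = subst_vars (fun l => f l \mPo t) p.
Proof.
rewrite /subst_vars (comp_mpolyEX p) [RHS]comp_mpolyEX raddf_sum /=.
apply: eq_bigr => u _; rewrite !comp_mpolyZ; congr (_ *: _).
rewrite !comp_mpolyX rmorph_prod /=; apply: eq_bigr => i _.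
by rewrite rmorphXn /= !tnth_mktuple.
Qed.

Lemma subst_id (p : R) : subst_vars (@var k d) p = p.
Proof.
rewrite -[RHS]comp_mpoly_id; congr comp_mpoly; apply: eq_mktuple => i.
by rewrite /var enum_valK.
Qed.

End Substitution.

Section Theta.
Variables (k : comNzRingType) (d : nat) (hd : (3 <= d)%N).
Local Notation R := (polyLambda k d).
Local Notation x i := ('X_(inord i) : {mpoly k[3]}).

Definition theta (q : {mpoly k[3]}) : {mpoly k[3]} :=
  q \mPo [tuple x 0; x 1 * x 2; x 1 ^+ d + x 2 ^+ d].

Lemma thetaX a b c : theta 'X_[mnm3 a b c] =
  x 0 ^+ a * (x 1 * x 2) ^+ b * (x 1 ^+ d + x 2 ^+ d) ^+ c.
Proof.
rewrite /theta comp_mpolyX !big_ord_recl big_ord0 mulr1 !mnmE /= mulrA.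
by rewrite /tnth /=.
Qed.

(** The monomial of theta (y_0^a y_1^b y_2^c) of least degree in x_2 is
x_0^a x_1^(b + dc) x_2^b, and it determines a, b and c. *)
Lemma mcoeff_thetaX a b c a' b' c' : (b' <= b)%N ->
  (theta 'X_[mnm3 a b c])@_(mnm3 a' (b' + d * c') b') =
  ((a, b, c) == (a', b', c'))%:R.
Proof.
move=> leb; rewrite thetaX exprDn mulr_sumr raddf_sum /=.
have E (j : 'I_c.+1) : (x 0 ^+ a * (x 1 * x 2) ^+ b * (x 1 ^+ d ^+ (c - j) *
    x 2 ^+ d ^+ j *+ 'C(c, j)))@_(mnm3 a' (b' + d * c') b') =
    if j == ord0 then ((a, b, c) == (a', b', c'))%:R else 0.
  rewrite mulrnAr mcoeffMn exprMn -!exprM !mpolyXn -!mpolyXD mcoeffX.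
  rewrite [X in X == _]mnm3E; set u := mnm3 _ _ _; set v := mnm3 _ _ _.
  have -> : u == v = [&& a == a', b == b', j == ord0 & c == c'].
    have -> : u = mnm3 a (b + d * (c - j)) (b + d * j).
      rewrite /u; congr mnm3;
        by rewrite !mnmDE !mulmnE !mnm1E -!val_eqE /= !inordK //=; lia.
    apply/eqP/and4P => [uv|[/eqP-> /eqP-> /eqP-> /eqP->]]; last first.
      by rewrite muln0 subn0 addn0.
    have [e0 e1 e2] := mnm3_coord a (b + d * (c - j)) (b + d * j).
    have [e0' e1' e2'] := mnm3_coord a' (b' + d * c') b'.
    rewrite uv in e0 e1 e2; rewrite e0' in e0; rewrite e1' in e1; rewrite e2' in e2.
    have j0 : nat_of_ord j = 0%N by nia.
    rewrite j0 subn0 in e1; split; apply/eqP => //; [lia|exact: val_inj|nia].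
  rewrite !xpair_eqE; case: (j =P ord0) => [->|_] /=; last by rewrite !andbF mul0rn.
  by rewrite bin0 mulr1n andbA.
by rewrite (eq_bigr _ (fun j _ => E j)) -big_mkcond big_pred1_eq.
Qed.

Lemma seq_argmin (T : eqType) (f : T -> nat) (s : seq T) : s != [::] ->
  exists2 u, u \in s & {in s, forall v, f u <= f v}%N.
Proof.
elim: s => // y s IHs _; have [->|/IHs [u us umin]] := eqVneq s [::].
  by exists y; rewrite ?mem_head // => v; rewrite inE => /eqP ->.
have [yu|uy] := leqP (f y) (f u).
  exists y => [|v]; rewrite ?mem_head // inE => /orP[/eqP->//|/umin].
  exact: leq_trans.
exists u => [|v]; rewrite inE ?us ?orbT // => /orP[/eqP->|/umin //].
exact: ltnW.
Qed.

(** At a monomial u of q with least exponent of y_1, the coefficient of the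
lowest term of theta 'X_[u] in theta q comes from u alone. *)
Lemma theta_inj q : theta q = 0 -> q = 0.
Proof.
move=> th0; apply/eqP; rewrite -msupp_eq0; apply: contraT.
move=> /(seq_argmin (fun u : 'X_{1..3} => u (inord 1)))[u uq umin].
have := congr1 (mcoeff (mnm3 (u (inord 0)) (u (inord 1) + d * u (inord 2))
  (u (inord 1)))) th0.
rewrite mcoeff0 /theta comp_mpolyEX raddf_sum /=.
have E v : v \in msupp q ->
    (q@_v *: theta 'X_[v])@_(mnm3 (u (inord 0)) (u (inord 1) + d * u (inord 2))
      (u (inord 1))) = if v == u then q@_v else 0.
  move=> vq; rewrite mcoeffZ [in 'X_[v]](mnm3E v) mcoeff_thetaX; last exact: umin.
  have -> : ((v (inord 0), v (inord 1), v (inord 2)) ==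
    (u (inord 0), u (inord 1), u (inord 2))) = (v == u).
    apply/eqP/eqP => [[e0 e1 e2]|->//].
    by rewrite (mnm3E v) (mnm3E u) e0 e1 e2.
  by case: eqP; rewrite ?mulr1 ?mulr0.
rewrite big_seq (eq_bigr _ E) -big_seq -big_mkcond /= -big_filter.
by rewrite filter_pred1_uniq ?msupp_uniq // big_seq1 => /eqP; rewrite mcoeff_eq0 uq.
Qed.

Let i20 : Lambda d := idx (in_Lambda_20 hd).
Let idd : Lambda d := idx (in_Lambda_dd hd).
Let w (l : Lambda d) : R := var k l.

Lemma phi_varE l : l != i20 -> phi_var k l = theta (psi_var k l).
Proof.
move=> l20; rewrite psi_varE // /expo_var thetaX /phi_var.
have [_ h] := LambdaP hd l; rewrite (fstLE hd l).
have hl1 := ht_le1 l20.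
case: (ht l) h hl1 => [|[|]] // h _.
  rewrite addn0 eqxx /mon3 expr0 mulr1 exprMn mulrA.
  congr (_ ^+ _ * _ ^+ _ * _ ^+ _); lia.
have -> : ((sndL l + 1)%N%:Z == (sndL l)%:Z) = false by lia.
rewrite expr1 !exprMn mulrDr /mon3 mulrA.
have -> : absz ((2 - (sndL l + 1)%N%:Z) * d%:Z + (d%:Z - 2) * (sndL l)%:Z)%R =
  (2 * d - (2 * sndL l + d * 1))%N by nia.
have -> : absz ((sndL l + 1)%N%:Z * d%:Z - (d%:Z - 1) * (sndL l)%:Z)%R =
  (d + sndL l)%N by nia.
by rewrite absz_nat !exprD; ring.
Qed.

(** x_1^(2d) + x_2^(2d) + 2 (x_1 x_2)^d is the square of x_1^d + x_2^d. *)
Lemma phi_var20 : phi_var k i20 + 2 * phi_var k idd = theta (psi_var k i20).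
Proof.
rewrite psi_varE // /expo_var thetaX /phi_var.
have [e0 e1] := idx20 hd; have [e2 e3] := idxdd hd.
rewrite -/i20 -/idd in e0 e1 e2 e3.
rewrite !(fstLE hd) e0 e1 e2 e3 addn0 eqxx /mon3 /=.
have -> : absz ((2 - (0 + 2)%N%:Z) * d%:Z + (d%:Z - 2) * 0%:Z)%R = 0%N by lia.
have -> : absz ((0 + 2)%N%:Z * d%:Z - (d%:Z - 1) * 0%:Z)%R = (d * 2)%N by lia.
have -> : absz (2 * d%:Z - 2 * d%:Z)%R = 0%N by lia.
have -> : (2 * d - (2 * 0 + d * 2))%N = 0%N by lia.
by rewrite !expr0 !exprM; ring.
Qed.

Lemma phi_rho (p : R) : phi (rho_tilde hd p) = theta (psi p).
Proof.
rewrite /phi /rho_tilde {1}/subst_vars subst_comp /theta /psi subst_comp.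
apply: eq_subst => l; rewrite -/(theta _) -/(subst_vars _ _).
case: eqP => [->|/eqP l20]; last by rewrite -phi_varE // [LHS]subst_var.
rewrite -phi_var20 /subst_vars raddfD /= rmorphM /= rmorph_nat.
by congr (_ + _ * _); apply: subst_var.
Qed.

(** A preimage is obtained by the inverse substitution
w_(2,0) |-> w_(2,0) - 2 w_(d,d). *)
Lemma rho_surj (p : R) : exists q, p = rho_tilde hd q.
Proof.
exists (subst_vars (fun l => if l == i20 then w i20 - 2 * w idd else w l) p).
rewrite -[LHS]subst_id /rho_tilde [RHS]subst_comp; apply: eq_subst => l.
have dd20 : (idd == i20) = false.
  by apply/eqP => /(congr1 (@ht d)); rewrite (proj2 (idxdd hd)).
have rho_w l' : w l' \mPo [tuple if enum_val i == i20 then w i20 + 2 * w idd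
    else w (enum_val i) | i < #|{: Lambda d}|] =
    if l' == i20 then w i20 + 2 * w idd else w l'.
  exact: (subst_var (fun l => if l == i20 then w i20 + 2 * w idd else w l) l').
case: ifP => [/eqP->|l20]; last by rewrite [RHS]rho_w l20.
rewrite raddfB /= rmorphM /= rmorph_nat.
rewrite [X in X - _]rho_w [X in _ - _ * X]rho_w.
by rewrite dd20 addrK.
Qed.

Lemma surface_ideal_image :
  same_set (@surface_ideal k d) (image_of (rho_tilde hd) (kernel (@psi k d))).
Proof.
move=> p; split=> [|[q kq ->]].
  have [q ->] := rho_surj p; rewrite /surface_ideal /kernel phi_rho.
  by move/theta_inj => kq; exists q.
by rewrite /surface_ideal /kernel phi_rho kq; apply: raddf0.
Qed.

End Theta.

(** * The quadrics of the surface *)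

Section SurfaceQuadrics.
Variables (k : comNzRingType) (d : nat) (hd : (3 <= d)%N).
Local Notation R := (polyLambda k d).
Local Notation ideal G := (@span_of R R^o G).
Local Notation L := (Lambda d).
Implicit Types l : L.
Let i20 : L := idx (in_Lambda_20 hd).
Let idd : L := idx (in_Lambda_dd hd).
Let rv l : R := rho_tilde hd (var k l).

Lemma rho_var l :
  rv l = if l == i20 then var k i20 + 2 * var k idd else var k l.
Proof. exact: subst_var. Qed.

Lemma rho_quadric l1 l2 l3 l4 :
  rho_tilde hd (var k l1 * var k l2 - var k l3 * var k l4) =
  rv l1 * rv l2 - rv l3 * rv l4.
Proof. by rewrite /rv /rho_tilde /subst_vars rmorphB !rmorphM. Qed.

(** If the apex occurs on one side only, the total height 2 of that side forces
its other point into the bottom row, and the image is a trinomial of the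
statement; if it occurs on both sides it cancels and leaves 0. *)
Lemma rho_quadric_through20 l2 l3 l4 :
  (fstL i20 + fstL l2 = fstL l3 + fstL l4)%N ->
  (sndL i20 + sndL l2 = sndL l3 + sndL l4)%N ->
  ideal (quadrics (k:=k) hd) (rv i20 * rv l2 - rv l3 * rv l4).
Proof.
have cancel l l' : (fstL i20 + fstL l = fstL i20 + fstL l')%N ->
    (sndL i20 + sndL l = sndL i20 + sndL l')%N ->
    ideal (quadrics (k:=k) hd) (rv i20 * rv l - rv i20 * rv l').
  move=> /addnI ef /addnI es; rewrite (_ : l = l') ?subrr; first exact: span0.
  by apply: (Lambda_eq hd); rewrite /ht ?ef ?es.
move=> ef es; have [e3|n3] := eqVneq l3 i20.
  by rewrite e3 in ef es *; apply: cancel.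
have [e4|n4] := eqVneq l4 i20.
  by rewrite e4 in ef es *; rewrite (mulrC (rv l3)); apply: cancel; lia.
have h3 := ht_le1 n3; have h4 := ht_le1 n4.
have [e0 e2] := idx20 hd; rewrite -/i20 in e0 e2.
rewrite !(fstLE hd) e0 e2 in ef; rewrite e0 in es.
have h2 : ht l2 = 0%N by lia.
have n2 : l2 != i20 by apply: contraTneq isT => E; rewrite E e2 in h2.
apply: ideal_gen; right; exists l2, l3, l4; rewrite !(fstLE hd) h2.
split; rewrite ?rho_var ?eqxx ?(negbTE n2) ?(negbTE n3) ?(negbTE n4) //; lia.
Qed.

Lemma rho_toric_quadric q : toric_quadrics q ->
  ideal (quadrics (k:=k) hd) (rho_tilde hd q).
Proof.
move=> [l1 [l2 [l3 [l4 [ef es ->]]]]]; rewrite rho_quadric.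
have [e1|n1] := eqVneq l1 i20.
  by rewrite e1 in ef es *; apply: rho_quadric_through20.
have [e2|n2] := eqVneq l2 i20.
  rewrite e2 in ef es *; rewrite (mulrC (rv l1)).
  by apply: rho_quadric_through20; lia.
have [e3|n3] := eqVneq l3 i20.
  rewrite e3 in ef es *; rewrite -opprB; apply: (@spanN R R^o).
  by apply: rho_quadric_through20; lia.
have [e4|n4] := eqVneq l4 i20.
  rewrite e4 in ef es *; rewrite -opprB (mulrC (rv l3)); apply: (@spanN R R^o).
  by apply: rho_quadric_through20; lia.
apply: ideal_gen; left; exists l1, l2, l3, l4.
by rewrite !rho_var !ifN_eq.
Qed.

Lemma quadrics_rho p : quadrics hd p ->
  exists2 q : R, toric_quadrics q & p = rho_tilde hd q.
Proof.
move=> [[l1 [l2 [l3 [l4 [[n1 n2 n3 n4] ef es ->]]]]]|].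
  exists (var k l1 * var k l2 - var k l3 * var k l4).
    by exists l1, l2, l3, l4.
  by rewrite rho_quadric !rho_var !ifN_eq.
move=> [l1 [l2 [l3 [e1 [n2 n3] ef es ->]]]].
have [e0 e2] := idx20 hd; rewrite -/i20 in e0 e2.
exists (var k i20 * var k l1 - var k l2 * var k l3).
  by exists i20, l1, l2, l3; rewrite (fstLE hd i20) e0 e2; split=> //; lia.
have n1 : l1 != i20 by apply: contraTneq isT => E; move: e2; rewrite /ht -E e1 subnn.
by rewrite rho_quadric !rho_var eqxx !ifN_eq.
Qed.

Lemma quadrics_generate : ideal_generated (quadrics (k:=k) hd) (@surface_ideal k d).
Proof.
move=> p; split=> [/(surface_ideal_image hd)[q kq ->]|].
  have := proj1 (toric_quadrics_generate hd q) kq.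
  move: q {kq}; apply: idealP => [|a g q tg hq].
    by rewrite /rho_tilde /subst_vars raddf0; apply: span0.
  rewrite /rho_tilde /subst_vars raddfD /= rmorphM /=.
  by apply: idealD => //; apply/idealM/rho_toric_quadric.
move: p; apply: idealP => [|a g p /quadrics_rho[q tq ->] hp].
  by rewrite /surface_ideal /kernel /phi /subst_vars raddf0.
have kq : surface_ideal (rho_tilde hd q).
  apply/(surface_ideal_image hd); exists q => //.
  by apply: (proj2 (toric_quadrics_generate hd q)); apply: ideal_gen.
move: kq hp; rewrite /surface_ideal /kernel /phi /subst_vars => kq hp.
by rewrite raddfD /= hp rmorphM /= kq mulr0 addr0.
Qed.

Lemma var_homog (l : L) : var k l \is 1.-homog.
Proof. by rewrite dhomogX /= mdeg1. Qed.

Lemma quadric_homog (l1 l2 l3 l4 : L) :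
  var k l1 * var k l2 - var k l3 * var k l4 \is 2.-homog.
Proof. by apply: rpredB; apply: (@dhomogM _ _ _ 1 _ 1); apply: var_homog. Qed.

Lemma toric_quadrics_homog (q : R) : toric_quadrics q -> q \is 2.-homog.
Proof. by move=> [l1 [l2 [l3 [l4 [_ _ ->]]]]]; apply: quadric_homog. Qed.

Lemma toric_quadrics_binomial (q : R) : toric_quadrics q -> is_binomial q.
Proof.
move=> [l1 [l2 [l3 [l4 [_ _ ->]]]]].
exists (U_(enum_rank l1) + U_(enum_rank l2))%MM, (U_(enum_rank l3) + U_(enum_rank l4))%MM.
by rewrite !mpolyXD.
Qed.

Lemma quadrics_homog (q : R) : quadrics hd q -> q \is 2.-homog.
Proof.
move=> [[l1 [l2 [l3 [l4 [_ _ _ ->]]]]]|[l1 [l2 [l3 [_ _ _ _ ->]]]]].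
  exact: quadric_homog.
apply: rpredB; apply: (@dhomogM _ _ _ 1 _ 1); try exact: var_homog.
apply: rpredD; first exact: var_homog.
rewrite mulr_natl; apply: rpredMn; exact: var_homog.
Qed.

Lemma toric_quadrics_finite :
  exists s : seq R, forall q, toric_quadrics q <-> q \in s.
Proof.
exists [seq (let: (l1, l2, l3, l4) := t in var k l1 * var k l2 - var k l3 * var k l4)
  | t : (L * L * L * L)%type in fun t => let: (l1, l2, l3, l4) := t in
      (fstL l1 + fstL l2 == fstL l3 + fstL l4)%N &&
      (sndL l1 + sndL l2 == sndL l3 + sndL l4)%N].
move=> q; split=> [[l1 [l2 [l3 [l4 [ef es ->]]]]]|].
  by apply/imageP; exists (l1, l2, l3, l4); rewrite // unfold_in ef es !eqxx.
move=> /imageP[[[[l1 l2] l3] l4]]; rewrite unfold_in => /andP[/eqP ef /eqP es] ->.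
by exists l1, l2, l3, l4.
Qed.

Lemma quadrics_finite : exists s : seq R, forall q, quadrics hd q <-> q \in s.
Proof.
pose s1 := [seq (let: (l1, l2, l3, l4) := t in var k l1 * var k l2 - var k l3 * var k l4)
  | t : (L * L * L * L)%type in fun t => let: (l1, l2, l3, l4) := t in
      [&& l1 != i20, l2 != i20, l3 != i20, l4 != i20,
       (fstL l1 + fstL l2 == fstL l3 + fstL l4)%N &
       (sndL l1 + sndL l2 == sndL l3 + sndL l4)%N]].
pose s2 := [seq (let: (l1, l2, l3) := t in (var k i20 + 2 * var k idd) * var k l1
  - var k l2 * var k l3) | t : (L * L * L)%type in fun t => let: (l1, l2, l3) := t in
      [&& fstL l1 == sndL l1, l2 != i20, l3 != i20,
       (sndL l1 + 2 == fstL l2 + fstL l3)%N &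
       (sndL l1 == sndL l2 + sndL l3)%N]].
exists (s1 ++ s2) => q; rewrite mem_cat; split.
  case=> [[l1 [l2 [l3 [l4 [[n1 n2 n3 n4] ef es ->]]]]]|].
    apply/orP; left; apply/imageP; exists (l1, l2, l3, l4) => //.
    by rewrite unfold_in; apply/and5P; split=> //; rewrite ef es !eqxx.
  move=> [l1 [l2 [l3 [e1 [n2 n3] ef es ->]]]].
  apply/orP; right; apply/imageP; exists (l1, l2, l3) => //.
  by rewrite unfold_in; apply/and5P; split=> //; apply/eqP.
case/orP=> /imageP.
  move=> [[[[l1 l2] l3] l4]]; rewrite unfold_in.
  move=> /and5P[n1 n2 n3 n4 /andP[/eqP ef /eqP es]] ->.
  by left; exists l1, l2, l3, l4.
move=> [[[l1 l2] l3]]; rewrite unfold_in.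
move=> /and5P[/eqP e1 n2 n3 /eqP ef /eqP es] ->.
by right; exists l1, l2, l3.
Qed.

End SurfaceQuadrics.

Theorem theorem4p9 (k : closedFieldType) (char0 : [pchar k] =i pred0)
  (d : nat) (hd : (3 <= d)%N) :
  (binomial_ideal (kernel (@psi k d)) /\
   exists B : polyLambda k d -> Prop,
     (forall b, B b -> is_binomial b /\ b \is 2.-homog) /\
     ideal_minimally_generated B (kernel (@psi k d)))
  /\
  (same_set (@surface_ideal k d)
     (image_of (@rho_tilde k d hd) (kernel (@psi k d))) /\
   minimally_generates_up_to_linear (@quadrics k d hd) (@surface_ideal k d)).
Proof.
have [s sE] := toric_quadrics_finite k d; have [t tE] := quadrics_finite k hd.
split; split.
- exists (@toric_quadrics k d); split; first exact: toric_quadrics_binomial.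
  exact: toric_quadrics_generate.
- have [B [sB mB]] := homog_minimal_generators_exist
    (@toric_quadrics_homog k d) sE (toric_quadrics_generate hd).
  exists B; split=> // b /sB tb.
  by split; [apply: toric_quadrics_binomial|apply: toric_quadrics_homog].
- exact: surface_ideal_image.
- exact: (homog_minimally_generates (@quadrics_homog k d hd) tE
    (@quadrics_generate k d hd)).
Qed.
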